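(* Let $N\ge 2$ be an integer, let $\Gamma:\mathbb{R}\to\mathbb{R}$ be an admissible coupling function (as defined in the context), let $\delta\in[0,\pi/2)$ and let $k\in\mathbb{R}$ with $k>-1$. Consider on the torus $(\mathbb{R}/2\pi\mathbb{Z})^N$ the system $\dot{\mathbf{x}}=\mathbf{\Omega}+C\,\boldsymbol{\Gamma}(\mathbf{x})$, with $C$, $\boldsymbol{\Gamma}$ and $\mathbf{\Omega}$ (depending on $k$, $\delta$, $\Gamma$, $N$) as given in the context. Then every equilibrium $x_*$ of this system satisfies $$\nu_0(x_* )=\nu_s(x_* )\quad\text{and}\quad \nu_\pi(x_* )=\nu_u(x_* ),$$ where $\nu_0(x_* )$ is the number of components of $x_*$ equal to $\delta$ (mod $2\pi$), $\nu_\pi(x_* )$ is the number of components of $x_*$ equal to $\pi-\delta$ (mod $2\pi$), $\nu_s(x_* )$ is the dimension of the stable manifold of $x_*$, and $\nu_u(x_* )$ is the dimension of the unstable manifold of $x_*$.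
   Context: An admissible coupling function is a continuously differentiable function $\Gamma:\mathbb{R}\to\mathbb{R}$ such that: (1) $\Gamma$ is $2\pi$-periodic and $|\Gamma(x)|\le 1$ for all $x$; (2) $\Gamma(-x)=-\Gamma(x)$ and $\Gamma(\pi/2-x)=\Gamma(\pi/2+x)$ for all $x$; (3) $\Gamma'(x)>0$ for $x\in[0,\pi/2)$. (The prototypical example is $\Gamma(x)=\sin x$.) For $\mathbf{x}=(x_1,\dots,x_N)^T$ put $\boldsymbol{\Gamma}(\mathbf{x})=(\Gamma(x_1),\dots,\Gamma(x_N))^T$. The matrix $C\in\mathbb{R}^{N\times N}$ is tridiagonal with $C_{i,i}=-(1+k)$ for $1\le i\le N$, $C_{i,i+1}=1$ and $C_{i+1,i}=k$ for $1\le i\le N-1$, and all other entries $0$. The vector $\mathbf{\Omega}\in\mathbb{R}^N$ has components $\Omega_1=k\,\Gamma(\delta)$, $\Omega_i=0$ for $2\le i\le N-1$, and $\Omega_N=\Gamma(\delta)$ (so that $(\delta,\dots,\delta)$ is an equilibrium). The stable and unstable manifolds of an equilibrium $x_*$ are those associated with the linearization $J=C\,\boldsymbol{\Gamma}'(x_* )$, where $\boldsymbol{\Gamma}'(x_* )=\operatorname{diag}(\Gamma'(x_{*,1}),\dots,\Gamma'(x_{*,N}))$: $\nu_s(x_* )$ (resp. $\nu_u(x_* )$) is the number of eigenvalues of $J$, counted with algebraic multiplicity, with negative (resp. positive) real part. *)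

(* Defs.v *)
From HB Require Import structures.
From mathcomp Require Import all_boot all_order all_algebra.
From mathcomp Require Import all_classical all_reals all_analysis.
From mathcomp Require Import complex.

Set Implicit Arguments.
Unset Strict Implicit.
Unset Printing Implicit Defensive.

Import Order.TTheory GRing.Theory Num.Theory.
Import numFieldNormedType.Exports.

Local Open Scope ring_scope.

Record admissible (R : realType) (Gamma : R -> R) : Prop := Admissible {
  admissible_derivable : forall x : R, derivable Gamma x 1;
  admissible_continuous_derive : continuous (Gamma^`()%classic : R -> R);
  admissible_periodic : forall x : R, Gamma (x + 2 * pi) = Gamma x;
  admissible_bounded : forall x : R, `|Gamma x| <= 1;
  admissible_odd : forall x : R, Gamma (- x) = - Gamma x;
  admissible_symmetric : forall x : R, Gamma (pi / 2 - x) = Gamma (pi / 2 + x);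
  admissible_increasing :
    forall x : R, 0 <= x -> x < pi / 2 -> 0 < Gamma^`()%classic x
}.

(* Indices start at 0: the entries (i, i + 1) are 1, the entries (i + 1, i)
   are k. *)
Definition coupling_mx (R : realType) (N : nat) (k : R) : 'M[R]_N :=
  \matrix_(i, j)
    if i == j then - (1 + k)
    else if j == i.+1 :> nat then 1
    else if i == j.+1 :> nat then k
    else 0.

(* For 1 < N the first and the last index are distinct. *)
Definition forcing (R : realType) (N : nat) (Gamma : R -> R) (delta k : R) :
    'cV[R]_N :=
  \col_i
    if i == 0%N :> nat then k * Gamma delta
    else if i.+1 == N then Gamma delta
    else 0.

(* A point of the torus (R / 2 pi Z)^N is given by any of its representatives
   x in R^N; all notions below depend only on x modulo 2 pi when Gamma is
   2 pi-periodic. *)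
Definition vector_field (R : realType) (N : nat) (Gamma : R -> R) (delta k : R)
    (x : 'cV[R]_N) : 'cV[R]_N :=
  forcing N Gamma delta k + coupling_mx N k *m map_mx Gamma x.

Definition equilibrium (R : realType) (N : nat) (Gamma : R -> R) (delta k : R)
    (x : 'cV[R]_N) : Prop :=
  vector_field Gamma delta k x = 0.

Definition linearization (R : realType) (N : nat) (Gamma : R -> R) (k : R)
    (x : 'cV[R]_N) : 'M[R]_N :=
  coupling_mx N k *m diag_mx (map_mx (Gamma^`()%classic) x)^T.

(* The characteristic polynomial being monic, this is the list of its N complex
   roots, each repeated according to its algebraic multiplicity. *)
Definition complex_eigenvalues (R : realType) (N : nat) (A : 'M[R]_N) :
    seq (complex R) :=
  sval (closed_field_poly_normal (char_poly (map_mx (real_complex R) A))).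

Definition stable_dim (R : realType) (N : nat) (Gamma : R -> R) (k : R)
    (x : 'cV[R]_N) : nat :=
  count (fun z : complex R => complex.Re z < 0)
    (complex_eigenvalues (linearization Gamma k x)).

Definition unstable_dim (R : realType) (N : nat) (Gamma : R -> R) (k : R)
    (x : 'cV[R]_N) : nat :=
  count (fun z : complex R => 0 < complex.Re z)
    (complex_eigenvalues (linearization Gamma k x)).

Definition eq_mod_2pi (R : realType) (a b : R) : Prop :=
  exists m : int, a = b + m%:~R * (2 * pi).

Definition num_components (R : realType) (N : nat) (x : 'cV[R]_N) (a : R) :
    nat :=
  #|[set i : 'I_N | `[< eq_mod_2pi (x i ord0) a >]]|.

(* Main.v *)
Require Import Defs.
From mathcomp Require Import all_boot all_order all_algebra.
From mathcomp Require Import all_classical all_reals all_analysis.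
From mathcomp Require Import complex zify ring lra.

Set Implicit Arguments.
Unset Strict Implicit.
Unset Printing Implicit Defensive.

Import Order.TTheory GRing.Theory Num.Theory.
Import numFieldNormedType.Exports.
Local Open Scope ring_scope.
Local Open Scope sesquilinear_scope.

(** For k > -1 the symmetric part of the coupling matrix C is negative definite:
    up to the factor -(1 + k) / 2 the form u C u^T is
    u_0^2 + sum_i (u_i - u_(i+1))^2 + u_(N-1)^2.  Hence C is injective, an
    equilibrium satisfies Gamma (x_i) = Gamma delta for every i, so that x_i is
    delta or pi - delta mod 2 pi, and g_i = Gamma' (x_i) is positive in the
    first case and negative in the second.

    For J = C diag(g) and the Hermitian matrix H = diag(1 / g) the form
    u J H u^* = u C u^* has negative real part.  Each eigenvector v of J then
    has v H v^* <> 0 of sign opposite to the real part of the eigenvalue, and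
    the H-orthogonal complement of v inherits the hypotheses (with J compressed to
    it).  By induction J is triangular in an H-orthogonal basis, and Sylvester's
    law of inertia compares the signs of H in that basis with those of g. *)

(** * Characteristic polynomials and deflation along an orthogonal complement *)

Lemma char_poly_intertwine (F : fieldType) (n : nat) (P A B : 'M[F]_n) :
  P \in unitmx -> P *m A = B *m P -> char_poly A = char_poly B.
Proof.
move=> Pu PA; rewrite /char_poly.
have Pdet : \det (map_mx polyC P) != 0.
  by rewrite det_map_mx polyC_eq0 -unitfE -unitmxE.
apply: (mulfI Pdet); rewrite -det_mulmx mulrC -det_mulmx; congr (\det _).
rewrite /char_poly_mx mulmxBr mulmxBl -!map_mxM PA.
by rewrite scalar_mxC.
Qed.

Lemma char_poly_lblock (F : fieldType) (m n : nat) (A : 'M[F]_m)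
    (C : 'M[F]_(n, m)) (B : 'M[F]_n) :
  char_poly (block_mx A 0 C B) = char_poly A * char_poly B.
Proof.
rewrite /char_poly /char_poly_mx map_block_mx map_mx0 scalar_mx_block.
by rewrite opp_block_mx add_block_mx !subr0 sub0r det_lblock.
Qed.

Lemma char_poly_mx11 (F : fieldType) (a : F) :
  char_poly (a%:M : 'M[F]_1) = 'X - a%:P.
Proof.
by rewrite /char_poly /char_poly_mx map_scalar_mx -raddfB det_scalar1.
Qed.

(** With [c = H v^*] the rows of [W] span the [H]-orthogonal complement of [v]; this is how
    [hermitian_schur] splits off an eigenvector. *)
Lemma kernel_column_basis (F : fieldType) (n : nat) (c : 'cV[F]_n.+1) :
  c != 0 -> exists2 W : 'M[F]_(n, n.+1), row_free W & W *m c = 0.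
Proof.
move=> c0.
have rkc : \rank c = 1%N.
  by apply/eqP; rewrite eqn_leq rank_leq_col lt0n mxrank_eq0 c0.
have rk : \rank (kermx c) = n by rewrite mxrank_ker rkc subn1.
have Wc : row_base (kermx c) *m c = 0.
  by apply/sub_kermxP; rewrite eq_row_base.
have := row_base_free (kermx c); move: (row_base _) Wc; rewrite rk => W.
by exists W.
Qed.

(** The rows of [P] are the [H]-orthogonal basis and [d] holds the values of [H] on them. Of the
    triangular form of [A] only the diagonal [l] is kept, through the characteristic polynomial. *)
Lemma hermitian_schur (K : numClosedFieldType) (n : nat) (A H : 'M[K]_n) :
    H ^t* = H ->
    (forall u : 'rV_n, u != 0 -> 'Re ((u *m A *m H *m u ^t*) 0 0) < 0) ->
  exists (P : 'M[K]_n) (l d : 'rV[K]_n),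
    [/\ P \in unitmx, char_poly A = \prod_i ('X - (l 0 i)%:P),
        P *m H *m P ^t* = diag_mx d &
        forall i, d 0 i \is Num.real /\ 'Re (l 0 i) * d 0 i < 0].
Proof.
elim: n A H => [|n IHn] A H Hherm Aneg.
  exists 1%:M, 0, 0; split => [|||[]//]; first exact: unitmx1.
    by rewrite /char_poly det_mx00 big_ord0.
  by apply/matrixP => -[].
have [a /eigenvalueP[v vA v0]] := eigenvalue_closed A (ltn0Sn n).
pose h := (v *m H *m v ^t*) 0 0.
have Ev : v *m H *m v ^t* = h%:M by rewrite [LHS]mx11_scalar.
have h_real : h \is Num.real.
  apply/CrealP; rewrite /h.
  have -> : ((v *m H *m v ^t*) 0 0)^* = ((v *m H *m v ^t*) ^t*) 0 0.
    by rewrite !mxE.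
  by rewrite !trmx_mul !map_mxM trmxCK Hherm mulmxA.
have ah : 'Re a * h < 0.
  have := Aneg v v0; rewrite vA -!scalemxAl mxE -/h.
  by rewrite mulrC ReMl // mulrC.
have h0 : h != 0 by apply: contraTneq ah => ->; rewrite mulr0 ltxx.
have c0 : H *m v ^t* != 0.
  by apply: contraNneq h0 => c0; rewrite /h -mulmxA c0 mulmx0 mxE.
have [W Wfree Wc] := kernel_column_basis c0.
have vW : v *m H *m W ^t* = 0.
  rewrite -[LHS]trmxCK !trmx_mul !map_mxM !trmxCK Hherm Wc.
  by rewrite trmx0 map_mx0.
pose Q : 'M[K]_(1 + n) := col_mx v W.
(* Pairing a relation [u *m Q = 0] with [v] through [H] kills the coefficient of [v], since [h] is
   nonzero and [W] is orthogonal to [v]; freeness of [W] kills the others. *)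
have Qu : Q \in unitmx.
  rewrite -row_free_unit -kermx_eq0; apply/eqP/row_matrixP => i; rewrite row0.
  set u := row i _.
  have : u *m Q = 0 by rewrite -row_mul mulmx_ker row0.
  rewrite -[u]hsubmxK mul_row_col => uQ.
  have l0 : lsubmx u = 0.
    have := congr1 (mulmx^~ (H *m v ^t*)) uQ.
    rewrite mul0mx mulmxDl -[X in _ + X]mulmxA Wc mulmx0 addr0 -!mulmxA.
    rewrite [v *m _]mulmxA Ev mul_mx_scalar => /eqP.
    by rewrite scaler_eq0 (negPf h0) => /eqP.
  rewrite l0 mul0mx add0r in uQ.
  rewrite l0 (_ : rsubmx u = 0) ?row_mx0 //.
  by apply: (row_free_inj Wfree); rewrite uQ mul0mx.
pose B : 'M[K]_(1 + n) := Q *m A *m invmx Q.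
have QA : Q *m A = B *m Q by rewrite mulmxKV.
(* As [v] is a left eigenvector, the first row of [B] is [a] followed by zeros, so [B] is block
   lower triangular. *)
have [Bu Bur] : ulsubmx B = a%:M /\ ursubmx B = 0.
  have : usubmx B = row_mx a%:M 0.
    have : usubmx B *m Q = row_mx a%:M 0 *m Q.
      rewrite mul_usub_mx -QA mul_row_col mul0mx addr0 mul_col_mx col_mxKu vA.
      by rewrite mul_scalar_mx.
    by move/(congr1 (mulmx^~ (invmx Q))); rewrite !mulmxK.
  by rewrite /ulsubmx /ursubmx => ->; rewrite row_mxKl row_mxKr.
pose A' := drsubmx B.
have WA : W *m A = dlsubmx B *m v + A' *m W.
  have := congr1 dsubmx QA; rewrite mul_col_mx col_mxKd -mul_dsub_mx => ->.
  by rewrite -[dsubmx B]hsubmxK mul_row_col.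
pose H' := W *m H *m W ^t*.
have [||P [l [d [Pu charA' PH ld]]]] := IHn A' H'.
- by rewrite /H' !trmx_mul !map_mxM trmxCK Hherm mulmxA.
(* The [v]-component of [W *m A] is orthogonal to [W], so the form of [A'] and [H'] at [u] is that
   of [A] and [H] at [u *m W]. *)
- move=> u u0; have uW0 : u *m W != 0.
    by apply: contraNneq u0 => uW; apply/eqP/(row_free_inj Wfree);
      rewrite uW mul0mx.
  have := Aneg _ uW0; rewrite -[u *m W *m A]mulmxA WA mulmxDr mulmxDl.
  rewrite trmx_mul map_mxM !mulmxA mulmxDl -!mulmxA.
  rewrite [v *m (H *m _)]mulmxA vW !mulmx0 add0r.
  by rewrite /H' !mulmxA.
exists (block_mx 1%:M 0 0 P *m Q : 'M[K]_(1 + n)).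
exists (row_mx a%:M l : 'rV[K]_(1 + n)), (row_mx h%:M d : 'rV[K]_(1 + n)).
split.
- rewrite unitmx_mul Qu andbT unitmxE.
  by rewrite (@det_lblock _ 1 n) det1 mul1r -unitmxE.
- rewrite (char_poly_intertwine Qu QA) -[B]submxK Bu Bur char_poly_lblock.
  rewrite char_poly_mx11 charA' (@big_split_ord _ _ _ 1) /= big_ord1.
  rewrite (@row_mxEl _ 1 1 n) mxE.
  by congr (_ * _); apply: eq_bigr => i _; rewrite (@row_mxEr _ 1 1 n).
- have QH : Q *m H *m Q ^t* = block_mx h%:M 0 0 H'.
    rewrite /Q mul_col_mx tr_col_mx map_row_mx mul_col_row Ev vW -/H'.
    by rewrite -[W *m H *m _]mulmxA Wc.
  pose S : 'M[K]_(1 + n) := block_mx 1%:M 0 0 P.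
  have St : S ^t* = block_mx 1%:M 0 0 (P ^t*).
    by rewrite /S tr_block_mx map_block_mx !trmx0 !map_mx0 trmx1 map_mx1.
  have SH : S *m (block_mx h%:M 0 0 H') *m S ^t* = diag_mx (row_mx h%:M d).
    rewrite St /S !mulmx_block.
    rewrite !(mul0mx, mulmx0, addr0, add0r, mul1mx, mulmx1) PH diag_mx_row.
    congr (block_mx _ _ _ _); rewrite -diag_const_mx; congr diag_mx.
    by apply/rowP => i; rewrite !mxE ord1.
  by rewrite -SH -QH trmx_mul map_mxM !mulmxA.
- move=> i; have [j ->|j ->] := @split_ordP 1 n i.
    by rewrite !(@row_mxEl _ 1 1 n) !ord1 !mxE.
  by rewrite !(@row_mxEr _ 1 1 n).
Qed.

(** * Sylvester's law of inertia for diagonal forms *)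

Lemma diag_form (K : numClosedFieldType) (n : nat) (d w : 'rV[K]_n) :
  (w *m diag_mx d *m w ^t*) 0 0 = \sum_i d 0 i * `|w 0 i| ^+ 2.
Proof.
rewrite mul_mx_diag mxE; apply: eq_bigr => i _.
by rewrite !mxE normCK mulrA [d _ _ * _]mulrC.
Qed.

(* If there were more positive entries in d than in s, some nonzero w supported
   on the former would have w P vanishing on the latter; the form at w would be
   both positive and nonpositive.  P need not be invertible. *)
Lemma sylvester_pos_le (K : numClosedFieldType) (n : nat) (P : 'M[K]_n)
    (s d : 'rV[K]_n) :
    (forall i, s 0 i \is Num.real) -> P *m diag_mx s *m P ^t* = diag_mx d ->
  (#|[set i | (0 < d 0 i)%R]| <= #|[set i | (0 < s 0 i)%R]|)%N.
Proof.
move=> s_real PsP; rewrite leqNgt; apply/negP => card_lt.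
set D := [set i | 0 < d _ i] in card_lt.
set S := [set i | 0 < s _ i] in card_lt.
pose f (i : 'I_#|D|) : 'I_n := enum_val i.
pose g (i : 'I_#|S|) : 'I_n := enum_val i.
pose M : 'M[K]_(#|D|, #|S|) := colsub g (rowsub f P).
have /rowV0Pn[u /sub_kermxP uM u0] : kermx M != 0.
  rewrite kermx_eq0 /row_free neq_ltn; apply/orP; left.
  exact: leq_ltn_trans (rank_leq_col M) card_lt.
pose w := u *m rowsub f 1%:M.
have wf i : w 0 (f i) = u 0 i.
  rewrite mxE (bigD1 i) //= !mxE eqxx mulr1 big1 ?addr0 // => j ji.
  by rewrite !mxE (inj_eq enum_val_inj) (negPf ji) mulr0.
have wD j : j \notin D -> w 0 j = 0.
  move=> jD; rewrite mxE big1 // => i _; rewrite !mxE.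
  by case: eqP jD => [<-|_]; rewrite ?mulr0 // enum_valP.
have wPS j : j \in S -> (w *m P) 0 j = 0.
  move=> jS; have := congr1 (fun A : 'rV[K]_#|S| => A 0 (enum_rank_in jS j)) uM.
  rewrite /M mulmx_colsub mxE /g enum_rankK_in // => uPj.
  by rewrite /w -mulmxA mul_rowsub_mx mul1mx uPj mxE.
have := diag_form d w; rewrite -PsP.
have -> : w *m (P *m diag_mx s *m P ^t*) *m w ^t* =
          (w *m P) *m diag_mx s *m (w *m P) ^t*.
  by rewrite (trmx_mul w P) map_mxM !mulmxA.
rewrite diag_form => sum_eq.
have : \sum_i s 0 i * `|(w *m P) 0 i| ^+ 2 <= 0.
  apply: sumr_le0 => i _; case: (boolP (i \in S)) => [/wPS->|].
    by rewrite normr0 expr0n mulr0.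
  rewrite inE -real_leNgt // ?real0 // => si.
  by rewrite mulr_le0_ge0 // exprn_ge0.
rewrite sum_eq; apply/negP; rewrite lt_geF //.
have term_ge0 i : 0 <= d 0 i * `|w 0 i| ^+ 2.
  case: (boolP (i \in D)) => [|/wD->]; last by rewrite normr0 expr0n mulr0.
  by rewrite inE => /ltW di; rewrite mulr_ge0 // exprn_ge0.
have [i ui] : exists i, u 0 i != 0.
  by apply/rV0Pn.
rewrite (bigD1 (f i)) //= ltr_wpDr ?sumr_ge0 //.
have := enum_valP i; rewrite inE -/(f i) => di.
by rewrite mulr_gt0 // exprn_gt0 // normr_gt0 wf.
Qed.

Lemma sylvester_neg_le (K : numClosedFieldType) (n : nat) (P : 'M[K]_n)
    (s d : 'rV[K]_n) :
    (forall i, s 0 i \is Num.real) -> P *m diag_mx s *m P ^t* = diag_mx d ->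
  (#|[set i | (d 0 i < 0)%R]| <= #|[set i | (s 0 i < 0)%R]|)%N.
Proof.
move=> s_real PsP.
have NE (t : 'rV[K]_n) : [set i | t 0 i < 0] = [set i | 0 < (- t) 0 i].
  by apply/setP => i; rewrite !inE mxE oppr_gt0.
rewrite !NE; apply: (@sylvester_pos_le _ _ P) => [i|].
  by rewrite mxE realN.
have diagN (t : 'rV[K]_n) : diag_mx (- t) = - diag_mx t by exact: linearN.
by rewrite !diagN mulmxN mulNmx PsP.
Qed.

(** * Inertia of a negative definite matrix times a real diagonal matrix *)

(** Links the real part of a closed field, which stays in [complex R], with the projection to [R]
    that counts eigenvalues. *)
Lemma Re_complex (R : rcfType) (z : complex R) :
  'Re z = real_complex R (complex.Re z).
Proof. by rewrite ReJ_add ReE. Qed.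

(** With [u = a + i b] the cross terms are [i (b C a^T - a C b^T)], purely imaginary because [C] is
    real, even if it is not symmetric. *)
Lemma Re_sesquilinear_form (R : rcfType) (n : nat) (C : 'M[R]_n)
    (u : 'rV[complex R]_n) :
  let a := map_mx (@complex.Re R) u in let b := map_mx (@complex.Im R) u in
  complex.Re ((u *m map_mx (real_complex R) C *m u ^t*) 0 0) =
    (a *m C *m a^T) 0 0 + (b *m C *m b^T) 0 0.
Proof.
move=> a b; rewrite !mxE.
rewrite (raddf_sum (@complex.Re R : {additive Rcomplex R -> R})) -big_split /=.
apply: eq_bigr => j _; rewrite !mxE.
have -> : \sum_i u 0 i * map_mx (real_complex R) C i j =
    Complex (\sum_i a 0 i * C i j) (\sum_i b 0 i * C i j).
  apply/eqP; rewrite eq_complex; apply/andP; split; apply/eqP => /=.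
    rewrite (raddf_sum (@complex.Re R : {additive Rcomplex R -> R})).
    apply: eq_bigr => i _; rewrite !mxE; case: (u 0 i) => x y /=.
    by rewrite mulr0 subr0.
  rewrite (raddf_sum (@complex.Im R : {additive Rcomplex R -> R})).
  apply: eq_bigr => i _; rewrite !mxE; case: (u 0 i) => x y /=.
  by rewrite mulr0 add0r mulrC.
case: (u 0 j) => x y /=.
by rewrite mulrN opprK.
Qed.

Lemma count_map_enum (T : finType) (S : Type) (f : T -> S) (a : pred S) :
  count a [seq f x | x <- enum T] = #|[set x | a (f x)]|.
Proof.
rewrite count_map -sum1_count big_enum_cond -sum1_card.
by apply: eq_bigl => x; rewrite !inE.
Qed.

Lemma inertia_neg_definite_mul_diag (R : realType) (n : nat) (C : 'M[R]_n)
    (g : 'rV[R]_n) :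
    (forall u : 'rV[R]_n, u != 0 -> (u *m C *m u^T) 0 0 < 0) ->
    (forall i, g 0 i != 0) ->
  count (fun z => complex.Re z < 0) (complex_eigenvalues (C *m diag_mx g)) =
    #|[set i | (0 < g 0 i)%R]| /\
  count (fun z => 0 < complex.Re z) (complex_eigenvalues (C *m diag_mx g)) =
    #|[set i | (g 0 i < 0)%R]|.
Proof.
move=> Cneg g0.
pose s : 'rV[complex R]_n := \row_i real_complex R (g 0 i)^-1.
have s_real i : s 0 i \is Num.real by rewrite mxE; apply/complex_realP; eexists.
have sgt i : (0 < s 0 i) = (0 < g 0 i) by rewrite mxE ltcR invr_gt0.
have slt i : (s 0 i < 0) = (g 0 i < 0) by rewrite mxE ltcR invr_lt0.
have gs : map_mx (real_complex R) (diag_mx g) *m diag_mx s = 1%:M.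
  rewrite map_diag_mx mulmx_diag -diag_const_mx; congr diag_mx.
  by apply/rowP => i; rewrite !mxE -rmorphM divff.
have [||P [l [d [Pu charA PsP ld]]]] :=
    @hermitian_schur _ n (map_mx (real_complex R) (C *m diag_mx g)) (diag_mx s).
- rewrite tr_diag_mx map_diag_mx; congr diag_mx; apply/rowP => i.
  by rewrite mxE; apply/CrealP.
(* Here [J H = C], so the real part is the form of [C] at the real and imaginary parts of [u], which
   are not both zero. *)
- move=> u u0; rewrite map_mxM -!mulmxA.
  rewrite [map_mx _ (diag_mx g) *m _]mulmxA gs mul1mx mulmxA.
  rewrite Re_complex Re_sesquilinear_form ltcR.
  set a := map_mx _ u; set b := map_mx _ u.
  have form_le0 (v : 'rV[R]_n) : (v *m C *m v^T) 0 0 <= 0.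
    have [->|v0] := eqVneq v 0; first by rewrite !mul0mx mxE.
    exact/ltW/Cneg.
  have [a0|a0] := eqVneq a 0; last by rewrite ltr_wnDr // Cneg.
  rewrite ltr_wnDl // Cneg //; apply: contra_neq u0 => b0.
  apply/rowP => i; move/rowP: a0 => /(_ i); move/rowP: b0 => /(_ i).
  by rewrite !mxE; case: (u 0 i) => x y /= -> ->.
have d0 i : d 0 i != 0.
  by have [_] := ld i; apply: contraTneq => ->; rewrite mulr0 ltxx.
have pos_le := sylvester_pos_le s_real PsP.
have neg_le := sylvester_neg_le s_real PsP.
(* No entry of [s] or [d] vanishes, so for each the positive and negative counts add up to [n]; this
   turns the two Sylvester inequalities into equalities. *)
have split_card (K : numDomainType) (t : 'rV[K]_n) :
    (forall i, t 0 i \is Num.real) -> (forall i, t 0 i != 0) ->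
    (#|[set i | (0 < t 0 i)%R]| + #|[set i | (t 0 i < 0)%R]|)%N = n.
  move=> t_real t0; rewrite -[RHS]card_ord -(cardsC [set i | (0 < t 0 i)%R]).
  congr (_ + _)%N; apply: eq_card => i; rewrite !inE -real_leNgt ?real0 //.
  by rewrite lt_neqAle t0.
have d_real i : d 0 i \is Num.real by case: (ld i).
have s0 i : s 0 i != 0 by rewrite mxE fmorph_eq0 invr_eq0.
have card_s := split_card _ _ s_real s0.
have card_d := split_card _ _ d_real d0.
(* Both lists factor the same monic polynomial, hence agree up to order. *)
have /permP eigE : perm_eq (complex_eigenvalues (C *m diag_mx g))
    [seq l 0 i | i <- enum 'I_n].
  apply: prod_XsubC_eq; rewrite big_map big_enum /= -charA.
  rewrite /complex_eigenvalues; case: closed_field_poly_normal => r /= ->.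
  by rewrite (monicP (char_poly_monic _)) scale1r.
rewrite !eigE !count_map_enum.
have lE i : real_complex R (complex.Re (l 0 i)) * d 0 i < 0.
  by rewrite -Re_complex; case: (ld i).
have cards : #|[set i | 0 < d 0 i]%R| = #|[set i | 0 < g 0 i]%R| /\
    #|[set i | d 0 i < 0]%R| = #|[set i | g 0 i < 0]%R|.
  have <- : [set i | 0 < s 0 i]%R = [set i | 0 < g 0 i]%R.
    by apply/setP => i; rewrite !inE sgt.
  have <- : [set i | s 0 i < 0]%R = [set i | g 0 i < 0]%R.
    by apply/setP => i; rewrite !inE slt.
  have squeeze a b c e : (a <= b)%N -> (c <= e)%N -> (a + c = n)%N ->
      (b + e = n)%N -> a = b /\ c = e by lia.
  exact: squeeze pos_le neg_le card_d card_s.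
case: cards => <- <-; split; apply: eq_card => i; rewrite !inE.
  rewrite -[LHS](ltcR _ 0).
  have [di|di] := real_ltP (real0 _) (d_real i).
    by have := lE i; rewrite pmulr_llt0.
  have {}di : d 0 i < 0 by rewrite lt_neqAle d0.
  by apply/negbTE; have := lE i; rewrite nmulr_llt0 // => /lt_gtF ->.
rewrite -[LHS](ltcR 0).
have [di|di] := real_ltP (d_real i) (real0 _).
  by have := lE i; rewrite nmulr_llt0.
have {}di : 0 < d 0 i by rewrite lt_neqAle eq_sym d0.
by apply/negbTE; have := lE i; rewrite pmulr_llt0 // => /lt_gtF ->.
Qed.

(** * Negative definiteness of the coupling matrix *)

(** In closed form, [2 q] is the sum of [f 0 ^+ 2], the squares of consecutive differences and
    [f n ^+ 2]. Holding back [f n ^+ 2 / 2] makes the induction work: the next step completes the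
    square [(f n - f n.+1) ^+ 2 / 2]. *)
Lemma path_form_bound (R : realFieldType) (f : nat -> R) (n : nat) :
  let q := \sum_(0 <= i < n.+1) f i ^+ 2 - \sum_(0 <= i < n) f i * f i.+1 in
  f n ^+ 2 / 2 <= q /\
  (q <= f n ^+ 2 / 2 -> forall i, (i <= n)%N -> f i = 0).
Proof.
elim: n => [|n [IHle IH0]].
  rewrite big_nat1 big_geq // subr0; have f0 := sqr_ge0 (f 0%N).
  split; first lra.
  move=> le0 i; rewrite leqn0 => /eqP->; apply/eqP.
  by rewrite -sqrf_eq0; apply/eqP; lra.
set q := _ - _ in IHle IH0; cbv zeta.
rewrite big_nat_recr //= [X in _ - X]big_nat_recr //=.
have -> : forall a b c d : R, a + b - (c + d) = (a - c) + (b - d).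
  by move=> *; ring.
rewrite -/q.
have sq := sqr_ge0 (f n - f n.+1).
have sqE : (f n - f n.+1) ^+ 2 = f n ^+ 2 - 2 * (f n * f n.+1) + f n.+1 ^+ 2.
  by ring.
rewrite sqE in sq; split; first lra.
move=> le0; have {}/IH0 IH0 : q <= f n ^+ 2 / 2 by lra.
have fn := IH0 n (leqnn n); have sqn := sqr_ge0 (f n.+1).
have fn1 : f n.+1 = 0.
  by apply/eqP; rewrite -sqrf_eq0; apply/eqP; rewrite fn in IHle sq le0; lra.
by move=> i; rewrite leq_eqVlt => /predU1P[->//|]; exact: IH0.
Qed.

(** Taking [f] on [nat] lets neighbours be written without ordinal bounds; the guards drop those
    missing at the two ends. *)
Lemma coupling_mx_row (R : realType) (n : nat) (k : R) (f : nat -> R)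
    (i : 'I_n) :
  \sum_j coupling_mx n k i j * f j =
    - (1 + k) * f i + (if (i.+1 < n)%N then f i.+1 else 0)
    + (if (0 < i)%N then k * f i.-1 else 0).
Proof.
have sum_pt (c m : nat) (a : R) : (c < n)%N -> m = c ->
    \sum_(j < n) (if (j == c :> nat) then a else 0) * f j = a * f m.
  move=> cn ->; rewrite (bigD1 (Ordinal cn)) //= eqxx big1 ?addr0 // => j jc.
  by rewrite -val_eqE /= in jc; rewrite (negPf jc) mul0r.
(* At most one of the three tests on [j] succeeds, so the nested conditional is a sum of three. *)
have -> : \sum_j coupling_mx n k i j * f j =
    \sum_(j < n) (if (j == i :> nat) then - (1 + k) else 0) * f j +
    \sum_(j < n) (if (j == i.+1 :> nat) then 1 else 0) * f j +
    \sum_(j < n) (if (i == j.+1 :> nat) then k else 0) * f j.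
  rewrite -!big_split; apply: eq_bigr => j _ /=; rewrite mxE -!mulrDl.
  congr (_ * _); rewrite -val_eqE /= [(i : nat) == j]eq_sym.
  have [->|ji] := eqVneq (j : nat) (i : nat).
    by rewrite (ltn_eqF (ltnSn i)) !addr0.
  rewrite add0r; case: eqP => [->|]; last by rewrite add0r.
  by rewrite ifF ?addr0 //; apply/eqP; lia.
rewrite (sum_pt i i) //; congr (_ + _ + _).
  case: ifP => [lt|ge]; first by rewrite (sum_pt i.+1 i.+1) // mul1r.
  apply: big1 => j _; rewrite ifF ?mul0r //.
  by apply/eqP => ji; rewrite -ji ltn_ord in ge.
case: i => -[|i] /= lt.
  by apply: big1 => j _; rewrite mul0r.
rewrite -(sum_pt i i) //; last exact: ltnW.
by apply: eq_bigr => j _; rewrite eqSS eq_sym.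
Qed.

(** The superdiagonal contributes [q2] and the subdiagonal [k * q2], so the form is
    [- (1 + k) * (q1 - q2)], and [path_form_bound] applies to [q1 - q2]. *)
Lemma coupling_mx_neg_definite (R : realType) (n : nat) (k : R)
    (u : 'rV[R]_n) :
  -1 < k -> u != 0 -> (u *m coupling_mx n k *m u^T) 0 0 < 0.
Proof.
case: n u => [|n] u hk u0; first by rewrite thinmx0 eqxx in u0.
pose f (i : nat) : R := u 0 (inord i).
have uf (i : 'I_n.+1) : u 0 i = f i by rewrite /f inord_val.
have -> : (u *m coupling_mx n.+1 k *m u^T) 0 0 =
    \sum_(i < n.+1) f i * \sum_j coupling_mx n.+1 k i j * f j.
  rewrite -mulmxA mxE; apply: eq_bigr => i _; rewrite uf mxE; congr (_ * _).
  by apply: eq_bigr => j _; rewrite [u^T _ _]mxE uf.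
under eq_bigr => i _ do rewrite coupling_mx_row !mulrDr.
rewrite !big_split /=.
have -> : \sum_(i < n.+1) f i * (- (1 + k) * f i) =
    - (1 + k) * \sum_(0 <= i < n.+1) f i ^+ 2.
  by rewrite big_mkord mulr_sumr; apply: eq_bigr => i _; ring.
have -> : \sum_(i < n.+1) f i * (if (i.+1 < n.+1)%N then f i.+1 else 0) =
    \sum_(0 <= i < n) f i * f i.+1.
  rewrite big_mkord big_ord_recr /= ltnn mulr0 addr0; apply: eq_bigr => i _.
  by rewrite ltnS ltn_ord.
have -> : \sum_(i < n.+1) f i * (if (0 < i)%N then k * f i.-1 else 0) =
    k * \sum_(0 <= i < n) f i * f i.+1.
  rewrite big_mkord big_ord_recl /= mulr0 add0r mulr_sumr.
  by apply: eq_bigr => i _; rewrite /bump /= add1n; ring.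
have [_ f0] := path_form_bound f n.
have [le0 _] := path_form_bound f n.
set q1 := \sum_(0 <= i < n.+1) _ in f0 le0 *.
set q2 := \sum_(0 <= i < n) _ in f0 le0 *.
suff : f n ^+ 2 / 2 < q1 - q2.
  move=> lt; have := sqr_ge0 (f n) => sq.
  have -> : - (1 + k) * q1 + q2 + k * q2 = - ((1 + k) * (q1 - q2)) by ring.
  rewrite oppr_lt0 mulr_gt0 //; lra.
rewrite ltNge; apply: contra_neqN u0 => /f0 {}f0.
by apply/rowP => i; rewrite uf f0 ?mxE // -ltnS.
Qed.

(** * Equilibria *)

(** The rows of [C] sum to [- k] at the top, [- 1] at the bottom and [0] between; [1 < n] keeps the
    two ends distinct. *)
Lemma forcingE (R : realType) (n : nat) (Gamma : R -> R) (delta k : R) :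
  (1 < n)%N ->
  forcing n Gamma delta k = - (coupling_mx n k *m const_mx (Gamma delta)).
Proof.
move=> n1; apply/colP => i; rewrite !mxE.
under eq_bigr => j _ do rewrite [const_mx _ _ _]mxE.
rewrite (coupling_mx_row k (fun=> Gamma delta)).
case: i => i lt /=; case: i lt => [|i] lt /=; first by rewrite n1; ring.
have [->|ne] := eqVneq i.+2 n; first by rewrite ltnn; ring.
by rewrite ltn_neqAle ne lt /=; ring.
Qed.

Lemma equilibriumE (R : realType) (n : nat) (Gamma : R -> R) (delta k : R)
    (x : 'cV[R]_n) :
  (1 < n)%N -> -1 < k -> equilibrium Gamma delta k x ->
  forall i, Gamma (x i 0) = Gamma delta.
Proof.
move=> n1 hk; rewrite /equilibrium /vector_field forcingE // => eq0 i.
(* The vector field is [C y], and [y^T C y = 0] forces [y = 0]. *)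
pose y := map_mx Gamma x - const_mx (Gamma delta).
have Cy : coupling_mx n k *m y = 0 by rewrite mulmxBr addrC.
have y0 : y = 0.
  apply: contraPeq Cy => yn0; have yt0 : y^T != 0.
    by rewrite -trmx0 (inj_eq trmx_inj).
  have := coupling_mx_neg_definite hk yt0.
  by rewrite trmxK -mulmxA => neg Cy; rewrite Cy mulmx0 mxE ltxx in neg.
by have /colP/(_ i) := y0; rewrite !mxE => /eqP; rewrite subr_eq0 => /eqP.
Qed.

(** * Symmetries and level sets of the coupling function *)

Lemma admissible_periodz (R : realType) (Gamma : R -> R)
    (hGamma : admissible Gamma) (m : int) (x : R) :
  Gamma (x + m%:~R * (2 * pi)) = Gamma x.
Proof.
have perN n y : Gamma (y + n%:R * (2 * pi)) = Gamma y.
  elim: n => [|n IHn]; first by rewrite mul0r addr0.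
  by rewrite mulrSr mulrDl mul1r addrA admissible_periodic.
case: m => n; first exact: perN.
rewrite -(perN n.+1 (x + _)) NegzE mulrNz; congr Gamma; ring.
Qed.

Lemma admissible_reflect (R : realType) (Gamma : R -> R)
    (hGamma : admissible Gamma) (x : R) : Gamma (pi - x) = Gamma x.
Proof.
have -> : pi - x = pi / 2 - (x - pi / 2) by field.
by rewrite admissible_symmetric //; congr Gamma; field.
Qed.

Lemma admissible_derive_period (R : realType) (Gamma : R -> R)
    (hGamma : admissible Gamma) (m : int) (x : R) :
  Gamma^`()%classic (x + m%:~R * (2 * pi)) = Gamma^`()%classic x.
Proof.
set c := _ * _.
have := @derive1_comp R (fun y => y + c) Gamma x.
rewrite (_ : Gamma \o _ = Gamma); last first.
  by apply/funext => y /=; exact: admissible_periodz.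
rewrite (_ : (fun y => y + c)^`()%classic x = 1) ?mulr1; last first.
  by rewrite derive1E deriveD // derive_id derive_cst addr0.
by move=> -> //; exact: admissible_derivable.
Qed.

(** Chain rule on the reflection symmetry. This sign change is what makes components at [pi - delta]
    count as unstable. *)
Lemma admissible_derive_reflect (R : realType) (Gamma : R -> R)
    (hGamma : admissible Gamma) (x : R) :
  Gamma^`()%classic (pi - x) = - Gamma^`()%classic x.
Proof.
have := @derive1_comp R (fun y => pi - y) Gamma x.
rewrite (_ : Gamma \o _ = Gamma); last first.
  by apply/funext => y /=; exact: admissible_reflect.
rewrite (_ : (fun y => pi - y)^`()%classic x = -1); last first.
  by rewrite derive1E deriveB // derive_id derive_cst sub0r.
by rewrite mulrN1 => -> //; rewrite ?opprK //; exact: admissible_derivable.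
Qed.

(** The sign of the derivative gives strict growth on [[0, pi / 2]]; oddness extends it to
    [[- pi / 2, pi / 2]]. *)
Lemma admissible_inj (R : realType) (Gamma : R -> R)
    (hGamma : admissible Gamma) (x y : R) :
  - (pi / 2) <= x <= pi / 2 -> - (pi / 2) <= y <= pi / 2 ->
  Gamma x = Gamma y -> x = y.
Proof.
have incr a b : 0 <= a -> a < b -> b <= pi / 2 -> Gamma a < Gamma b.
  apply: gtr0_derive1_incr.
  - by move=> z _; exact: admissible_derivable.
  - move=> z; rewrite in_itv /= => /andP[z0 z1].
    by apply: admissible_increasing => //; exact: ltW.
  - apply: continuous_subspaceT => z.
    exact/differentiable_continuous/derivable1_diffP/admissible_derivable.
have G0 : Gamma 0 = 0.
  by have := admissible_odd hGamma 0; rewrite oppr0; lra.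
have lt_mono a b : - (pi / 2) <= a -> a < b -> b <= pi / 2 -> Gamma a < Gamma b.
  move=> ha ab hb; have [a0|a0] := leP 0 a; first exact: incr.
  have [b0|b0] := leP b 0.
    have := incr (- b) (- a); rewrite !admissible_odd //; lra.
  have := incr 0 (- a); rewrite G0 admissible_odd // => Ga.
  by have := incr 0 b; rewrite G0 => Gb; lra.
move=> /andP[x0 x1] /andP[y0 y1] Gxy; case: (ltgtP x y) => // xy.
  by have := lt_mono x y x0 xy y1; rewrite Gxy ltxx.
by have := lt_mono y x y0 xy x1; rewrite Gxy ltxx.
Qed.

Lemma admissible_level (R : realType) (Gamma : R -> R)
    (hGamma : admissible Gamma) (delta x : R) :
  0 <= delta -> delta < pi / 2 -> Gamma x = Gamma delta ->
  eq_mod_2pi x delta \/ eq_mod_2pi x (pi - delta).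
Proof.
move=> d0 d1 Gx; have pi0 := pi_gt0 R.
(* This [m] moves [x] into [[- pi / 2, 3 pi / 2)]; there either [y] or [pi - y] falls where [Gamma]
   is injective. *)
pose m := Num.floor ((x + pi / 2) / (2 * pi)).
pose y := x + (- m)%:~R * (2 * pi).
have xE : x = y + m%:~R * (2 * pi) by rewrite /y mulrNz; ring.
have Gy : Gamma y = Gamma delta by rewrite admissible_periodz.
have [y_ge y_lt] : - (pi / 2) <= y /\ y < 3 * pi / 2.
  have /andP[] := floor_itv ((x + pi / 2) / (2 * pi)).
  rewrite -/m ler_pdivlMr ?ltr_pdivrMr; lra.
have [y_le|y_gt] := leP y (pi / 2).
  left; exists m; rewrite [LHS]xE; congr (_ + _).
  by apply: (admissible_inj hGamma) => //; lra.
right; exists m; rewrite [LHS]xE; congr (_ + _).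
suff <- : pi - y = delta by ring.
by apply: (admissible_inj hGamma); rewrite ?admissible_reflect //; lra.
Qed.

Theorem theorem1 (R : realType) (N : nat) (Gamma : R -> R) (delta k : R)
    (hN : (2 <= N)%N) (hGamma : admissible Gamma)
    (hdelta0 : 0 <= delta) (hdelta : delta < pi / 2) (hk : -1 < k)
    (x : 'cV[R]_N) (hx : equilibrium Gamma delta k x) :
  num_components x delta = stable_dim Gamma k x /\
  num_components x (pi - delta) = unstable_dim Gamma k x.
Proof.
have dG0 := admissible_increasing hGamma hdelta0 hdelta.
have level i := admissible_level hGamma hdelta0 hdelta
  (equilibriumE hN hk hx i).
have dGd y : eq_mod_2pi y delta ->
    Gamma^`()%classic y = Gamma^`()%classic delta.
  by case=> m ->; exact: admissible_derive_period.
have dGp y : eq_mod_2pi y (pi - delta) ->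
    Gamma^`()%classic y = - Gamma^`()%classic delta.
  by case=> m ->; rewrite admissible_derive_period // admissible_derive_reflect.
pose g : 'rV[R]_N := (map_mx (Gamma^`()%classic) x)^T.
have gE i : g 0 i = Gamma^`()%classic (x i 0) by rewrite !mxE.
have [||st un] := @inertia_neg_definite_mul_diag _ _ (coupling_mx N k) g.
- by move=> u; exact: coupling_mx_neg_definite.
- move=> i; rewrite gE.
  by case: (level i) => [/dGd|/dGp] ->; rewrite ?oppr_eq0 gt_eqF.
rewrite /stable_dim /unstable_dim /linearization st un.
(* The sign of [g 0 i] decides which of the two alternatives of [level] holds. *)
split; apply: eq_card => i; rewrite !inE gE.
  apply/asboolP/idP => [/dGd -> //|].
  by case: (level i) => // /dGp ->; lra.
apply/asboolP/idP => [/dGp ->|]; first lra.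
by case: (level i) => // /dGd ->; lra.
Qed.
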